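(* For all hypercontracts $\mathcal{C}=(\mathcal{E},\mathcal{I})$ and $\mathcal{C}''=(\mathcal{E}'',\mathcal{I}'')$ in $\mathbf{Contr}$, the hypercontract quotient $\mathcal{C}''/\mathcal{C}$ is given, up to equivalence of hypercontracts, by $$\mathcal{C}''/\mathcal{C} = \left((\mathcal{C}'')^{-1}\parallel \mathcal{C}\right)^{-1}.$$ That is, for every $\mathcal{C}'\in\mathbf{Contr}$, $\mathcal{C}\parallel\mathcal{C}'\le\mathcal{C}''$ if and only if $\mathcal{C}'\le\left((\mathcal{C}'')^{-1}\parallel\mathcal{C}\right)^{-1}$.
   Context: Components. $(\mathbb{M},\le)$ is a preorder whose elements are called components, with a partial binary operation $\parallel$ (composition) that is associative, commutative, and monotonic in both arguments. Compsets. $\mathbf{CmpSet}$ is a lattice whose elements (compsets) are certain sets of components, ordered by inclusion: $H\le H'$ means $H\subseteq H'$ (meet and join need not be intersection and union). Composition of compsets is $H\parallel H'=\{M\parallel M' : M\in H,\ M'\in H',\ M \text{ and } M' \text{ composable}\}$; it is total, monotonic, commutative and associative. Hypercontracts. $\mathbf{Contr}$ is a lattice whose elements (hypercontracts) are certain pairs $\mathcal{C}=(\mathcal{E},\mathcal{I})$ of compsets ($\mathcal{E}$: environments, $\mathcal{I}$: implementations). The order (refinement) is: $(\mathcal{E},\mathcal{I})\le(\mathcal{E}',\mathcal{I}')$ iff $\mathcal{E}'\le\mathcal{E}$ and $\mathcal{I}\le\mathcal{I}'$. Two hypercontracts are equivalent if each refines the other. Parallel composition. For $\mathcal{C}_1=(\mathcal{E}_1,\mathcal{I}_1)$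 and $\mathcal{C}_2=(\mathcal{E}_2,\mathcal{I}_2)$ in $\mathbf{Contr}$, $\mathcal{C}_1\parallel\mathcal{C}_2$ is the smallest hypercontract $(\mathcal{E}',\mathcal{I}')\in\mathbf{Contr}$ (up to equivalence) satisfying the three requirements $\mathcal{I}_1\parallel\mathcal{I}_2\le\mathcal{I}'$, $\ \mathcal{E}'\parallel\mathcal{I}_1\le\mathcal{E}_2$, $\ \mathcal{E}'\parallel\mathcal{I}_2\le\mathcal{E}_1$ (in particular it satisfies these requirements itself). Parallel compositions of elements of $\mathbf{Contr}$ are assumed to exist. Mirror (reciprocal). $(\mathcal{E},\mathcal{I})^{-1}=(\mathcal{I},\mathcal{E})$. It is assumed that $\mathcal{C}^{-1}\in\mathbf{Contr}$ for each $\mathcal{C}\in\mathbf{Contr}$, and that whenever the infimum of a collection of hypercontracts exists, $\left(\bigwedge_i\mathcal{C}_i\right)^{-1}=\bigvee_i\mathcal{C}_i^{-1}$. Quotient. $\mathcal{C}''/\mathcal{C}$ is the hypercontract defined (up to equivalence) by the universal property: for all $\mathcal{C}'\in\mathbf{Contr}$, $\mathcal{C}\parallel\mathcal{C}'\le\mathcal{C}''$ if and only if $\mathcal{C}'\le\mathcal{C}''/\mathcal{C}$. *)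

(* Defs.v *)
From HB Require Import structures.
From mathcomp Require Import all_boot all_order.
From mathcomp Require Import boolp classical_sets.

Set Implicit Arguments.
Unset Strict Implicit.
Unset Printing Implicit Defensive.

Import Order.TTheory.
Local Open Scope order_scope.
Local Open Scope classical_set_scope.

(* [parm m n = None] means that m and n are not composable.  Commutativity and
   associativity are Kleene equalities: one side is defined iff the other is.
   Monotonicity only compares composites that are both defined. *)
HB.mixin Record isComponents d M of Order.Preorder d M := {
  parm : M -> M -> option M;
  parmC : forall m n, parm m n = parm n m;
  parmA : forall m n p,
    obind (fun q => parm q p) (parm m n) = obind (fun q => parm m q) (parm n p);
  parm_monol : forall m m' n p p', m <= m' ->
    parm m n = Some p -> parm m' n = Some p' -> p <= p';
  parm_monor : forall m n n' p p', n <= n' ->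
    parm m n = Some p -> parm m n' = Some p' -> p <= p'
}.

#[short(type="componentsType")]
HB.structure Definition Components d :=
  { M of Order.Preorder d M & isComponents d M }.

Definition parm_set d (M : componentsType d) (H H' : set M) : set M :=
  [set p | exists m n, [/\ H m, H' n & parm m n = Some p]].

(* A [subPOrderLattice] carries the order induced by its ambient lattice (here
   inclusion of sets of components), but its own meet and join, which need not
   be those of the ambient lattice. *)
Record compsets d (M : componentsType d) := Compsets {
  is_compset : pred (set M);
  compset_display : Order.disp_t;
  compset :> subPOrderLattice is_compset compset_display;
  parm_set_closed : forall H H' : compset,
    is_compset (parm_set (val H) (val H'))
}.

Definition parc d (M : componentsType d) (K : compsets M) (H H' : K) : K :=
  Sub (parm_set (val H) (val H')) (parm_set_closed H H').

(* Elements are pairs (E, I) of environments and implementations; taking the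
   dual order on E makes the product order the refinement order (see
   [refinesE]).  The last field says that the mirror of a hypercontract is a
   hypercontract. *)
Record hypercontracts d (M : componentsType d) (K : compsets M) :=
  Hypercontracts {
  is_contract : pred (K^d *p K);
  contract_display : Order.disp_t;
  contract :> subPOrderLattice is_contract contract_display;
  mirror_closed : forall C : contract, is_contract ((val C).2, (val C).1)
}.

Section Hypercontracts.
Context d (M : componentsType d) (K : compsets M) (L : hypercontracts K).
Implicit Types C Q : L.

Definition envs C : K := (val C).1.
Definition impls C : K := (val C).2.

Lemma refinesE C C' :
  (C <= C') = (envs C' <= envs C) && (impls C <= impls C').
Proof. by rewrite -Order.le_val. Qed.

Lemma compset_leP (H H' : K) : reflect (val H `<=` val H') (H <= H').
Proof. by rewrite -Order.le_val; apply: (iffP idP); rewrite subsetEset. Qed.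

Definition mirror C : L :=
  @Sub (K^d *p K)%type (is_contract L) L ((val C).2, (val C).1) (mirror_closed C).

Lemma envs_mirror C : envs (mirror C) = impls C.
Proof. by rewrite /envs SubK. Qed.

Lemma impls_mirror C : impls (mirror C) = envs C.
Proof. by rewrite /impls SubK. Qed.

Definition par_reqs C1 C2 : set L :=
  [set C | [/\ parc (impls C1) (impls C2) <= impls C,
               parc (envs C) (impls C1) <= envs C2 &
               parc (envs C) (impls C2) <= envs C1]].

Definition is_par C1 C2 C := par_reqs C1 C2 C /\ lbound (par_reqs C1 C2) C.

Definition is_quotient (par : L -> L -> L) C'' C Q :=
  forall C' : L, par C C' <= C'' <-> C' <= Q.

Definition equivalent C C' := C <= C' /\ C' <= C.

End Hypercontracts.

Arguments mirror {d M K L} C.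

(* Main.v *)
(** [par C1 C2] refines a hypercontract iff the latter satisfies the three
    requirements defining the composition, since these requirements are upward
    closed.  So [par C C' <= C''] means I || I' <= I'', E'' || I <= E' and
    E'' || I' <= E; these are also, up to commutativity, the requirements saying
    that [par (mirror C'') C <= mirror C'].  As the mirror exchanges
    the two components and reverses refinement, the latter is [C' <= mirror (par (mirror C'') C)]. *)
Require Import Defs.
From mathcomp Require Import all_boot all_order.
From mathcomp Require Import boolp classical_sets.

Set Implicit Arguments.
Unset Strict Implicit.
Unset Printing Implicit Defensive.

Import Order.TTheory.
Local Open Scope order_scope.
Local Open Scope classical_set_scope.

Section CompsetComposition.
Context (d : Order.disp_t) (M : componentsType d) (K : compsets M).
Implicit Types H : K.

Lemma parcC H H' : parc H H' = parc H' H.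
Proof.
apply: val_inj; rewrite !SubK; apply/seteqP; split=> p [m [n [Hm Hn mn]]];
  by exists n, m; split=> //; rewrite parmC.
Qed.

Lemma le_parcl H1 H2 H : H1 <= H2 -> parc H1 H <= parc H2 H.
Proof.
move=> /compset_leP le12; apply/compset_leP; rewrite !SubK => p.
by move=> [m [n [/le12 Hm Hn mn]]]; exists m, n.
Qed.

End CompsetComposition.

Section HypercontractComposition.
Context (d : Order.disp_t) (M : componentsType d) (K : compsets M).
Context (L : hypercontracts K).
Implicit Types C P Q : L.

Lemma le_mirrorC C C' : (C <= mirror C') = (C' <= mirror C).
Proof. by rewrite !refinesE !envs_mirror !impls_mirror andbC. Qed.

(** Passing from [P] to [Q] enlarges implementations, which bound from above, and shrinks
    environments, which occur inside a monotone composition. *)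
Lemma par_reqs_upward C1 C2 P Q :
  P <= Q -> par_reqs C1 C2 P -> par_reqs C1 C2 Q.
Proof.
rewrite refinesE => /andP[leE leI] [rI r1 r2]; split.
- exact: le_trans leI.
- exact: le_trans (le_parcl _ leE) r1.
- exact: le_trans (le_parcl _ leE) r2.
Qed.

Lemma is_par_le C1 C2 P Q : is_par C1 C2 P -> P <= Q <-> par_reqs C1 C2 Q.
Proof. by move=> [rP lbP]; split=> [/par_reqs_upward|/lbP]; [apply|]. Qed.

(** The first, second and third requirements on the left become the third, first and second on the
    right. *)
Lemma par_reqs_mirror C C' C'' :
  par_reqs C C' C'' <-> par_reqs (mirror C'') C (mirror C').
Proof.
rewrite /par_reqs /= !envs_mirror !impls_mirror.
rewrite (parcC (impls C') (envs C'')) (parcC (impls C') (impls C)).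
by split=> -[].
Qed.

(** Each quotient refines itself, so it can be fed to the universal property of the other. *)
Lemma is_quotient_equivalent (par : L -> L -> L) C C'' P Q :
  is_quotient par C'' C P -> is_quotient par C'' C Q -> equivalent P Q.
Proof. by move=> qP qQ; split; [apply/qQ/qP|apply/qP/qQ]. Qed.

End HypercontractComposition.

Theorem proposition1 (d : Order.disp_t) (M : componentsType d)
    (K : compsets M) (L : hypercontracts K)
    (mirror_inf : forall (A : set L) (C : L),
      infimums A C -> supremums (mirror @` A)%classic (mirror C))
    (par : L -> L -> L)
    (parP : forall C1 C2 : L, is_par C1 C2 (par C1 C2))
    (C C'' : L) :
  is_quotient par C'' C (mirror (par (mirror C'') C)) /\
  (forall Q : L, is_quotient par C'' C Q ->
     equivalent Q (mirror (par (mirror C'') C))).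
Proof.
have quo : is_quotient par C'' C (mirror (par (mirror C'') C)).
  move=> C'; rewrite le_mirrorC.
  by rewrite (is_par_le _ (parP _ _)) (is_par_le _ (parP _ _)) par_reqs_mirror.
by split=> // Q qQ; apply: is_quotient_equivalent qQ quo.
Qed.
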